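(* Let $p$ be an odd prime, let $v\ge p$ and $\lambda\ge1$ be integers with $v\not\equiv 0 \pmod p$, and let $X$ be a PSCA$(v,p,\lambda)$. For $w\in[v]$ and $0\le j\le p-1$, let $$y_w(j)=\sum_{\substack{0\le i\le v-1\\ i\equiv j \bmod p}} d_w(i).$$ Then $y_w(j)\equiv 0\pmod p$ for all $w\in[v]$ and all $0\le j\le p-1$.
   Context: For positive integers $v\ge t$, let $[v]=\{0,\dots,v-1\}$, let $\mathcal{S}_v$ be the set of permutations of $[v]$ (bijections $[v]\to[v]$), and let $\mathcal{S}_{v,t}$ be the set of ordered sequences of $t$ distinct elements of $[v]$. A sequence $s=(s_0,\dots,s_{t-1})\in\mathcal{S}_{v,t}$ is covered by $\pi\in\mathcal{S}_v$ if $\pi^{-1}(s_i)<\pi^{-1}(s_{i+1})$ for $0\le i\le t-2$. For a positive integer $\lambda$, a PSCA$(v,t,\lambda)$ is a multiset $X$ of permutations in $\mathcal{S}_v$ such that every sequence in $\mathcal{S}_{v,t}$ is covered by exactly $\lambda$ permutations in $X$ (counted with multiplicity). For a multiset $X$ of permutations of $[v]$, $w\in[v]$ and $0\le i\le v-1$, $d_w(i)=|\{\pi\in X:\pi(i)=w\}|$ (counted with multiplicity). *)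

(* Defs.v *)
From mathcomp Require Import all_boot all_fingroup.
From mathcomp Require Import finmap multiset.
Set Implicit Arguments. Unset Strict Implicit. Unset Printing Implicit Defensive.

Open Scope mset_scope.
Open Scope nat_scope.

(* A permutation pi of [v] is read as the word pi(0) pi(1) ... pi(v-1), so
   pi^-1 a is the position of the symbol a.  A duplicate-free sequence s is
   covered by pi when the positions of its consecutive entries increase. *)
Definition covered v (pi : 'S_v) (s : seq 'I_v) : bool :=
  sorted (fun a b : 'I_v => (pi^-1)%g a < (pi^-1)%g b) s.

(* X pi is the multiplicity of pi in the multiset X, so both this sum and the
   one in dcount count permutations of X with multiplicity. *)
Definition is_PSCA v t lambda (X : {mset 'S_v}) : Prop :=
  forall s : t.-tuple 'I_v, uniq s ->
    \sum_(pi : 'S_v | covered pi s) X pi = lambda.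

Definition dcount v (X : {mset 'S_v}) (w i : 'I_v) : nat :=
  \sum_(pi : 'S_v | pi i == w) X pi.

Definition ycount p v (X : {mset 'S_v}) (w : 'I_v) (j : nat) : nat :=
  \sum_(i < v | i == j %[mod p]) dcount X w i.

(* Main.v *)
Require Import Defs.
From mathcomp Require Import all_boot all_fingroup.
From mathcomp Require Import finmap multiset.

(** The first [p] binomial moments of the position of [w], namely the sums
    over [i] of [d_w(i) * 'C(i, j)] for [j < p], all vanish modulo [p], and they
    determine the residue-class sums [y_w] modulo [p].

    To compute the [j]-th moment, read ['C(i, j)] as the number of
    [j]-sequences [s] such that a permutation with [w] in position [i] covers
    [s] followed by [w].  Summing over [s] first requires the array to be
    balanced on sequences of length [j + 1], not only [p].  It is: when [x] does
    not occur in [s], every permutation covering [s] covers exactly one of the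
    insertions of [x] into [s], so strength [t + 1] and index [lambda] give
    strength [t] and index [(t + 1) * lambda] ([PSCA_pred], [PSCA_lower]).
    Hence the [j]-th moment is [(v - 1) ^_ j] times the index at strength
    [j + 1] ([dcount_bin_moment]).  For [j < p - 1] that index has the factor
    [p], acquired in the step from strength [p] to [p - 1].  For [j = p - 1] the
    factor [p] comes from [(v - 1) ^_ (p - 1)]: this is a product of [p - 1]
    consecutive integers, and [p] divides one of them because it does not
    divide [v] ([dvdn_ffact_pred]).

    Finally ['C(i, j)] modulo [p] depends only on [i] modulo [p] when [j < p]
    ([bin_modp]), so modulo [p] the moments are the sums of [y_w(k) * 'C(k, j)]
    over [k < p].  This linear system is triangular with unit diagonal, so its
    only solution modulo [p] is zero ([residue_sums_dvd]). *)

Section Insertion.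

Context {T : Type} (f : T -> nat).
Let below a b := f a < f b.

(** A new key fits into an increasing sequence in exactly one place, while no
    insertion can repair a sequence that is not increasing.  Working with
    [pairwise] rather than [sorted] lets the condition on the head separate from
    the place of insertion in the tail. *)
Lemma sum_pairwise_insert (x : T) (s : seq T) : all (fun b => f b != f x) s ->
  \sum_(k < (size s).+1) pairwise below (take k s ++ x :: drop k s)
    = pairwise below s.
Proof.
elim: s => [|b s IHs] /=; first by rewrite big_ord_recl big_ord0.
case/andP=> bx /IHs {}IHs; rewrite big_ord_recl /=.
under eq_bigr => k _ do
  rewrite all_cat /= andbCA -all_cat cat_take_drop -andbA -!mulnb.
rewrite -!big_distrr /= IHs {1}/below.
(* If [f b < f x] then only insertions after [b] survive; otherwise only the
   insertion in front does. *)
case: (ltngtP (f b) (f x)) bx => // [lt_bx|lt_xb] _ /=.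
  by rewrite add0n [below b x]lt_bx mul1n mulnb.
have -> : below b x = false by rewrite /below ltnNge (ltnW lt_xb).
rewrite mul0n addn0; congr nat_of_bool.
case b_s: (all (below b) s); rewrite ?andbF //=.
by rewrite (sub_all _ b_s) // => a; apply: ltn_trans.
Qed.

End Insertion.

Section Coverage.

Context {v : nat}.
Implicit Types (pi : 'S_v) (X : {mset 'S_v}) (s : seq 'I_v) (w x : 'I_v).

Lemma coveredE pi s :
  covered pi s = pairwise (fun a b => (pi^-1)%g a < (pi^-1)%g b) s.
Proof. by apply: sorted_pairwise => b a c; apply: ltn_trans. Qed.

Lemma sorted_pos_covered pi s :
  covered pi s = sorted ltn [seq val ((pi^-1)%g a) | a <- s].
Proof. by rewrite sorted_map. Qed.

Lemma covered_uniq pi s : covered pi s -> uniq s.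
Proof.
rewrite sorted_pos_covered => /(sorted_uniq ltn_trans ltnn).
exact: map_uniq.
Qed.

(** Double counting of the pairs of a permutation covering [s] and a slot of
    [s] in which a symbol [x] outside [s] may be inserted: each covering
    permutation admits one slot, and each of the [t + 1] slots is filled by
    [lambda] permutations. *)
Lemma PSCA_pred t lambda X : t < v ->
  is_PSCA t.+1 lambda X -> is_PSCA t (t.+1 * lambda) X.
Proof.
move=> lt_tv PX s uniq_s.
have [x x_s]: exists x, x \notin s.
  apply/existsP; rewrite -negb_forall; apply/negP => /forallP all_s.
  have : #|s| = #|'I_v| by apply: eq_card => a; rewrite all_s.
  rewrite (card_uniqP uniq_s) size_tuple card_ord => t_v.
  by rewrite t_v ltnn in lt_tv.
transitivity (\sum_(k < t.+1) \sum_(pi | covered pi (take k s ++ x :: drop k s))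
                 X pi).
  under [RHS]eq_bigr do rewrite big_mkcond.
  rewrite big_mkcond exchange_big /=; apply: eq_bigr => pi _.
  under [RHS]eq_bigr do rewrite -mulnbl coveredE.
  rewrite -big_distrl /=.
  have := sum_pairwise_insert (fun a => (pi^-1)%g a) x s.
  rewrite size_tuple => ->; first by rewrite -coveredE mulnbl.
  apply/allP => b b_s; rewrite val_eqE (inj_eq perm_inj).
  by apply: contraNneq x_s => <-.
rewrite -[t.+1 in RHS]card_ord -sum_nat_const; apply: eq_bigr => k _.
have sz : size (take k s ++ x :: drop k s) == t.+1.
  by rewrite size_cat /= addnS -size_cat cat_take_drop size_tuple.
apply: (PX (Tuple sz)) => /=.
by rewrite uniq_catC /= mem_cat orbC -mem_cat -uniq_catC cat_take_drop x_s.
Qed.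

Lemma PSCA_lower k t lambda X : k + t <= v ->
  is_PSCA (k + t) lambda X -> is_PSCA t ((k + t) ^_ k * lambda) X.
Proof.
elim: k lambda => [|k IHk] lambda le_v PX; first by rewrite mul1n.
rewrite addSn ffactnS /= mulnAC mulnC; apply: IHk; first exact: ltnW.
exact: PSCA_pred.
Qed.

(** An increasing sequence ending in [i] is determined by its other entries,
    which form an increasing sequence in ['I_i]. *)
Lemma card_sorted_rcons j (i : 'I_v) :
  #|[set s : j.-tuple 'I_v | sorted ltn (rcons (map val s) (val i))]|
    = 'C(i, j).
Proof.
rewrite -card_ltn_sorted_tuples.
have le_iv : i <= v := ltnW (ltn_ord i).
have widen_inj : injective (fun s : j.-tuple 'I_i => [tuple of map (widen_ord le_iv) s]).
  move=> s s' /(congr1 val) /= /inj_map E; apply/val_inj/E.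
  by move=> a b /(congr1 val) /= /val_inj.
rewrite -(card_imset _ widen_inj); apply: eq_card => s; rewrite inE.
rewrite sorted_pairwise ?pairwise_rcons -?sorted_pairwise; try exact: ltn_trans.
apply/andP/imsetP => [[/allP s_i sorted_s]|[s' + ->]] /=; last first.
  rewrite inE -map_comp => sorted_s'; split=> //.
  by apply/allP => _ /mapP[a _ ->] /=.
have lt_s k : tnth s k < i by apply/s_i/map_f/mem_tnth.
have E : s = [tuple of map (widen_ord le_iv) [tuple Ordinal (lt_s k) | k < j]].
  by apply: eq_from_tnth => k; rewrite tnth_map tnth_mktuple; apply: val_inj.
exists [tuple Ordinal (lt_s k) | k < j] => //.
by rewrite inE; move: sorted_s; rewrite {1}E /= -map_comp.
Qed.

Lemma card_covered_rcons j pi w :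
  #|[set s : j.-tuple 'I_v | covered pi (rcons s w)]| = 'C((pi^-1)%g w, j).
Proof.
have pi_inj : injective (fun s : j.-tuple 'I_v => [tuple of map (pi^-1)%g s]).
  by move=> s s' /(congr1 val) /= /inj_map E; apply/val_inj/E/perm_inj.
rewrite -card_sorted_rcons -[RHS](card_preimset _ pi_inj); apply: eq_card => s.
rewrite !inE sorted_pos_covered map_rcons /=.
by rewrite -map_comp.
Qed.

Lemma card_uniq_rcons j w :
  #|[set s : j.-tuple 'I_v | uniq (rcons s w)]| = v.-1 ^_ j.
Proof.
have <- : #|predC1 w| = v.-1 by rewrite cardC1 card_ord.
rewrite -card_uniq_tuples; apply: eq_card => s; rewrite !inE rcons_uniq.
congr (_ && _); apply/idP/allP => [w_s a a_s|all_s].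
  by apply: contraNneq w_s => <-.
by apply/negP => /all_s; rewrite inE eqxx.
Qed.

(** Both sides count, with multiplicity, the pairs of a permutation and a
    [j]-sequence [s] such that the permutation covers [rcons s w]. *)
Lemma dcount_bin_moment j lambda X w : is_PSCA j.+1 lambda X ->
  \sum_(i < v) dcount X w i * 'C(i, j) = v.-1 ^_ j * lambda.
Proof.
move=> PX; transitivity (\sum_(pi : 'S_v) 'C((pi^-1)%g w, j) * X pi).
  rewrite [RHS](partition_big (fun pi : 'S_v => (pi^-1)%g w) predT) //=.
  apply: eq_bigr => i _; rewrite big_distrl /=; apply: eq_big => [pi|pi /eqP <-].
    by rewrite eq_sym -(can_eq (permKV pi)) permK eq_sym.
  by rewrite permK mulnC.
rewrite -(card_uniq_rcons j w) -sum_nat_const [RHS]big_mkcond.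
under [LHS]eq_bigr do rewrite -card_covered_rcons -sum_nat_const big_mkcond.
rewrite exchange_big /=; apply: eq_bigr => s _; rewrite inE.
under eq_bigr do rewrite inE.
rewrite -big_mkcond /=; case: ifPn => [|not_uniq].
  by have /= := PX [tuple of rcons s w].
by apply: big1 => pi /covered_uniq uniq_s; rewrite uniq_s in not_uniq.
Qed.

End Coverage.

Section PrimeModulus.

Context (p : nat) (p_pr : prime p).

(** In Vandermonde's expansion of the left side, every ['C(p, a)] with
    [0 < a < p] is divisible by [p]. *)
Lemma bin_addp n j : j < p -> 'C(p + n, j) = 'C(n, j) %[mod p].
Proof.
move=> lt_jp; rewrite -Vandermonde big_ord_recl bin0 mul1n subn0.
rewrite -[in RHS](addn0 'C(n, j)) -modnDmr; congr ((_ + _) %% _).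
apply/eqP/dvdn_sum => a _; rewrite dvdn_mulr // prime_dvd_bin //=.
exact: leq_ltn_trans (ltn_ord a) lt_jp.
Qed.

Lemma bin_modp n j : j < p -> 'C(n, j) = 'C(n %% p, j) %[mod p].
Proof.
move=> lt_jp; rewrite [in LHS](divn_eq n p).
by elim: (n %/ p) => // q IHq; rewrite mulSn -addnA bin_addp.
Qed.

Lemma dvdn_ffact_pred v : v <> 0 %[mod p] -> p %| v.-1 ^_ p.-1.
Proof.
move=> v_p; have p_gt0 := prime_gt0 p_pr.
have v_gt0 : 0 < v by case: v v_p; rewrite ?mod0n.
(* As [p] does not divide [v], the residue of [v - 1] is below [p - 1], so the
   binomial coefficient ['C(v - 1, p - 1)] vanishes modulo [p]. *)
rewrite -bin_ffact dvdn_mulr // /dvdn bin_modp ?prednK //.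
rewrite bin_small ?mod0n // ltn_neqAle -ltnS prednK // ltn_pmod // andbT.
apply/eqP => E; apply: v_p; rewrite -(prednK v_gt0) -addn1 -modnDml E addn1.
by rewrite prednK // modnn mod0n.
Qed.

(** Modulo [p] the moments are those of the residue sums, and the matrix
    ['C(k, j)] with [j, k < p] is unitriangular; solving from [j = p - 1]
    downwards kills every residue sum. *)
Lemma residue_sums_dvd v (d : 'I_v -> nat) :
    (forall j, j < p -> p %| \sum_(i < v) d i * 'C(i, j)) ->
  forall j, j < p -> p %| \sum_(i < v | i == j %[mod p]) d i.
Proof.
move=> moments; have p_gt0 := prime_gt0 p_pr.
pose y j := \sum_(i < v | i == j %[mod p]) d i; rewrite -/(y _).
have moment_y j : j < p -> p %| \sum_(k < p) y k * 'C(k, j).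
  move=> lt_jp; suff eq_moments :
      \sum_(k < p) y k * 'C(k, j) = \sum_(i < v) d i * 'C(i, j) %[mod p].
    by rewrite /dvdn eq_moments -/(_ %| _) moments.
  pose r (i : 'I_v) := Ordinal (ltn_pmod i p_gt0).
  rewrite [in RHS](partition_big r predT) //= -[LHS]modn_summ -[RHS]modn_summ.
  congr (_ %% _); apply: eq_bigr => k _; rewrite big_distrl /=.
  rewrite (eq_bigl (fun i => r i == k)) => [|i]; last first.
    by rewrite -val_eqE /= (modn_small (ltn_ord k)).
  rewrite -[LHS]modn_summ -[RHS]modn_summ; congr (_ %% _).
  apply: eq_bigr => i /eqP <-.
  by rewrite /= -modnMmr -bin_modp // modnMmr.
move=> j; have [n] := ubnP (p - j); elim: n j => // n IHn j lt_pj lt_jp.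
have := moment_y j lt_jp.
rewrite (bigD1 (Ordinal lt_jp)) //= binn muln1 dvdn_addl //.
apply: dvdn_sum => k ne_kj; case: (ltngtP k j) => [lt_kj|lt_jk|eq_kj].
- by rewrite bin_small // muln0.
- apply: dvdn_mulr; apply: IHn => //.
  by apply: leq_trans (_ : p - j <= n) => //; apply: ltn_sub2l.
by rewrite -val_eqE /= eq_kj eqxx in ne_kj.
Qed.

End PrimeModulus.

Theorem theorem2p3 (p v lambda : nat) (X : {mset 'S_v}) :
  prime p -> odd p -> p <= v -> 1 <= lambda -> v <> 0 %[mod p] ->
  is_PSCA p lambda X ->
  forall (w : 'I_v) (j : nat), j < p -> ycount p X w j = 0 %[mod p].
Proof.
move=> p_pr _ le_pv _ v_p PX w j lt_jp; rewrite mod0n; apply/eqP.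
apply: (residue_sums_dvd p p_pr) lt_jp => {}j lt_jp.
have := PSCA_lower (p - j.+1) j.+1 lambda X.
rewrite subnK // => /(_ le_pv PX) /dcount_bin_moment ->.
case: (posnP (p - j.+1)) => [/eqP|pj_gt0]; last first.
  by rewrite -(prednK pj_gt0) ffactnS -mulnA dvdn_mull // dvdn_mulr.
rewrite subn_eq0 => le_pj; have -> : j = p.-1.
  by apply/eqP; rewrite -eqSS prednK ?prime_gt0 // eqn_leq lt_jp.
exact/dvdn_mulr/dvdn_ffact_pred.
Qed.
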